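(* Let $G$ be a Lie group endowed with a right-invariant Riemannian metric $\langle\cdot,\cdot\rangle_G$ with norm $\|\cdot\|_G$, and let $p=[(x_i,g_i)]\in E^{\mathrm{sph}}(G)$ have support $J=\{i:x_i\ne0\}$. Let $g$ be the metric given on tangent vectors $(v,\xi)$ at $p$ by the quadratic form $$g_p(v,\xi)=\sum_i v_i^2+\sum_i x_i^2\,\|\xi_i\|_G^2 .$$ Then: (1) $g_p$ is positive definite on $$\left\{(v_i)_{i\in\mathbb N}\ \text{finitely supported real sequence}\;\middle|\;\sum_{j\in J}x_jv_j=0\right\}\oplus\bigoplus_{j\in J}T_{g_j}G;$$ (2) $g_p$ vanishes on directions corresponding to variations of $g_i$ for indices $i\notin J$ (i.e. on vectors $(0,\xi)$ with $\xi_i\in T_{g_i}G$ and $\xi_j=0$ for all $j\in J$).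
   Context: Spherical Milnor space: $E^{\mathrm{sph}}(G)$ is the set of families $(x_i,g_i)_{i\in\mathbb N}$ with $x_i\in\mathbb R$ finitely supported, $\sum_i x_i^2=1$, $g_i\in G$, modulo $(x_i,g_i)\sim(x_i,g_i')$ iff $g_i=g_i'$ whenever $x_i\ne0$. Its finite local models are $S_I\times G^I$ ($I\subset\mathbb N$ finite, $S_I$ the unit sphere of $\mathbb R^I$), mapped to $E^{\mathrm{sph}}(G)$ by extension by zero and passage to the quotient. Tangent vectors at $p$ are computed in these local models (with $I\supset J$), at a representative $(x_i,g_i)$ of $p$: they are pairs $(v,\xi)$ with $v=(v_i)$ a finitely supported real sequence such that $\sum_i x_iv_i=0$ and $\xi=(\xi_i)$ a finitely supported family with $\xi_i\in T_{g_i}G$. The metric on $S_I\times G^I$ is $g_I=\sum_{i\in I}dx_i^2+\sum_{i\in I}x_i^2\langle\cdot,\cdot\rangle_G^{(i)}$, with $\langle\cdot,\cdot\rangle_G^{(i)}$ the metric on the $i$-th copy of $G$. *)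

(* Defs.v *)
From HB Require Import structures.
From mathcomp Require Import all_boot all_order all_algebra generic_quotient.
From mathcomp Require Import all_classical all_reals all_analysis.

Set Implicit Arguments.
Unset Strict Implicit.
Unset Printing Implicit Defensive.

Import Order.TTheory GRing.Theory Num.Theory numFieldNormedType.Exports.

Local Open Scope classical_set_scope.
Local Open Scope ring_scope.
Local Open Scope quotient_scope.

Section Smooth.
Variables (R : realType) (V W : normedModType R).

(* For open [U] and finite-dimensional [V], continuity of all the directional
   maps [x |-> 'd f x v] is the continuity of [x |-> 'd f x]. *)
Fixpoint C_k (k : nat) (U : set V) (f : V -> W) : Prop :=
  if k is k'.+1 then
    (forall x, U x -> differentiable f x) /\
    (forall v, C_k k' U (fun x => 'd f x v))
  else forall x, U x -> {for x, continuous f}.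

Definition smooth_on (U : set V) (f : V -> W) : Prop := forall k, C_k k U f.

End Smooth.

(* The values of [cfun] outside [cdom], and of [cinv] outside the image of
   [cdom], are irrelevant. *)
Record chart (R : realType) (n : nat) (M : topologicalType) := Chart {
  cdom : set M;
  cfun :> M -> 'rV[R]_n;
  cinv : 'rV[R]_n -> M;
  cdom_open : open cdom;
  cimage_open : open (cfun @` cdom);
  cfunK : forall x, cdom x -> cinv (cfun x) = x;
  cfun_continuous : forall x, cdom x -> {for x, continuous cfun};
  cinv_continuous : forall u, (cfun @` cdom) u -> {for u, continuous cinv} }.

HB.mixin Record hasAtlas (R : realType) (n : nat) M of Topological M := {
  atlas : set (chart R n M);
  atlas_cover : forall x : M, exists c, atlas c /\ cdom c x;
  atlas_compat : forall c c', atlas c -> atlas c' ->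
    smooth_on (c @` (cdom c `&` cdom c')) (c' \o cinv c);
  manifold_hausdorff : hausdorff_space M;
  manifold_second_countable : @second_countable M }.

#[short(type="manifoldType")]
HB.structure Definition Manifold (R : realType) (n : nat) :=
  {M of hasAtlas R n M & Topological M}.

(* The continuity hypotheses make the sets on which smoothness is required
   open. *)
HB.mixin Record isLieGroup (R : realType) (n : nat) G
    of Manifold R n G & Group G := {
  lie_mul_continuous : continuous (fun z : G * G => (z.1 * z.2)%g);
  lie_inv_continuous : continuous (fun x : G => x^-1%g);
  lie_mul_smooth : forall c c' c'' : chart R n G,
    atlas c -> atlas c' -> atlas c'' ->
    smooth_on
      [set z : 'rV[R]_n * 'rV[R]_n | [/\ (c @` cdom c) z.1,
         (c' @` cdom c') z.2 & cdom c'' (cinv c z.1 * cinv c' z.2)%g]]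
      (fun z => c'' (cinv c z.1 * cinv c' z.2)%g);
  lie_inv_smooth : forall c c' : chart R n G, atlas c -> atlas c' ->
    smooth_on
      [set u : 'rV[R]_n | (c @` cdom c) u /\ cdom c' (cinv c u)^-1%g]
      (fun u => c' (cinv c u)^-1%g) }.

#[short(type="lieGroupType")]
HB.structure Definition LieGroup (R : realType) (n : nat) :=
  {G of isLieGroup R n G & Manifold R n G & Group G}.

Section Tangent.
Variables (R : realType) (n : nat) (M : manifoldType R n).
Implicit Types g : M.

Definition chart_at g := {c : chart R n M | atlas c /\ cdom c g}.

Definition some_chart_at g : chart_at g := cid (atlas_cover g).

(* A tangent vector at [g] is a family of coordinate vectors, one for each
   chart at [g], related by the differentials of the changes of charts. *)
Definition tangent_pred g : {pred (chart_at g -> 'rV[R]_n)} :=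
  fun v => `[< forall c c' : chart_at g,
    v c' = 'd (sval c' \o cinv (sval c)) (sval c g) (v c) >].

Fact tangent_submod_closed g : submod_closed (@tangent_pred g).
Proof.
split=> [|a u v]; rewrite !unfold_in /tangent_pred.
  by apply/asboolP => c c'; rewrite linear0.
move=> /asboolP hu /asboolP hv; apply/asboolP => c c'.
by rewrite !fctE linearP -hu -hv.
Qed.

HB.instance Definition _ g :=
  GRing.isSubmodClosed.Build R (chart_at g -> 'rV[R]_n) (@tangent_pred g)
    (tangent_submod_closed g).

Record tangent g := Tangent {
  tcoord :> chart_at g -> 'rV[R]_n;
  _ : tcoord \in @tangent_pred g }.

HB.instance Definition _ g := [isSub for @tcoord g].
HB.instance Definition _ g := [Choice of tangent g by <:].
HB.instance Definition _ g := [SubChoice_isSubLmodule of tangent g by <:].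


Lemma diff_chain (U V W : normedModType R) (f : U -> V) (h : V -> W)
    (k : U -> W) (x v : U) (y : V) :
  f x = y -> (\near x, k x = h (f x)) ->
  differentiable f x -> differentiable h y -> differentiable k x ->
  'd k x v = 'd h y ('d f x v).
Proof.
move=> <- kE df dh dk.
have dhf := differentiable_comp df dh.
rewrite -(deriveE _ dk) (near_eq_derive (g := h \o f))//.
by rewrite (deriveE _ dhf) (diff_comp df dh).
Qed.

Lemma transition_differentiable g (c c' : chart_at g) :
  differentiable (sval c' \o cinv (sval c)) (sval c g).
Proof.
have [[ac cg] [ac' c'g]] := (svalP c, svalP c').
have [+ _] := atlas_compat _ _ ac ac' 1%N.
by apply; exists g.
Qed.

Lemma near_cinv g (c : chart_at g) (P : M -> Prop) :
  (\forall x \near g, P x) -> \forall u \near sval c g, P (cinv (sval c) u).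
Proof.
have [ac cg] := svalP c => gP.
apply: (@cinv_continuous _ _ _ (sval c) (sval c g)); first by exists g.
by rewrite cfunK.
Qed.

Lemma near_cdom g (c : chart_at g) : \forall x \near g, cdom (sval c) x.
Proof. by apply: open_nbhs_nbhs; split; [exact: cdom_open|case: (svalP c)]. Qed.

Fact tangent_of_chart_subproof g (c : chart_at g) (e : 'rV[R]_n) :
  (fun c' : chart_at g => 'd (sval c' \o cinv (sval c)) (sval c g) e)
    \in @tangent_pred g.
Proof.
rewrite unfold_in; apply/asboolP => c1 c2.
have [ac cg] := svalP c.
apply: diff_chain; [by rewrite /= cfunK| |exact: transition_differentiable..].
have := near_cinv c (near_cdom c1); apply: filterS => u hu.
by rewrite /= cfunK.
Qed.

(* The tangent vector at [g] with coordinates [e] in the chart [c]. *)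
Definition tangent_of_chart g (c : chart_at g) (e : 'rV[R]_n) : tangent g :=
  Tangent (tangent_of_chart_subproof c e).

(* The vector field on [cdom c] with constant coordinates [e] in [c]. *)
Definition coord_field (c : chart R n M) (e : 'rV[R]_n) g : tangent g :=
  if pselect (atlas c /\ cdom c g) is left h
  then tangent_of_chart (exist _ c h) e else 0.

End Tangent.

Section Differential.
Variables (R : realType) (n : nat) (M N : manifoldType R n).

(* Computed in arbitrarily chosen charts; see [differentialE]. *)
Definition differential (F : M -> N) (g : M) (v : tangent g) : tangent (F g) :=
  let c := some_chart_at g in let c' := some_chart_at (F g) in
  tangent_of_chart c' ('d (sval c' \o F \o cinv (sval c)) (sval c g) (v c)).

Lemma diff_change_charts (F : M -> N) (g : M) (v : tangent g)
    (a c : chart_at g) (b c' : chart_at (F g)) :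
  {for g, continuous F} ->
  (forall (d : chart_at g) (d' : chart_at (F g)),
    differentiable (sval d' \o F \o cinv (sval d)) (sval d g)) ->
  'd (sval c' \o cinv (sval b)) (sval b (F g))
    ('d (sval b \o F \o cinv (sval a)) (sval a g) (v a)) =
  'd (sval c' \o F \o cinv (sval c)) (sval c g) (v c).
Proof.
move=> Fg dF.
have ag : cdom (sval a) g by case: (svalP a).
have bFg : cdom (sval b) (F g) by case: (svalP b).
have cg : cdom (sval c) g by case: (svalP c).
have vE : v a = 'd (sval a \o cinv (sval c)) (sval c g) (v c).
  have : tcoord v \in @tangent_pred _ _ _ g by case: (v).
  by rewrite unfold_in => /asboolP; exact.
have E1 : 'd (sval c' \o F \o cinv (sval c)) (sval c g) (v c) =
    'd (sval c' \o F \o cinv (sval a)) (sval a g) (v a).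
  rewrite [v a]vE; apply: diff_chain; [by rewrite /= cfunK| |
    exact: transition_differentiable|exact: dF|exact: dF].
  have := near_cinv c (near_cdom a); apply: filterS => u hu.
  by rewrite /= cfunK.
apply: etrans (esym E1); apply: esym.
apply: diff_chain; [by rewrite /= cfunK| |
  exact: dF|exact: transition_differentiable|exact: dF].
have := near_cinv a (Fg _ (near_cdom b)); apply: filterS => u hu.
by rewrite /= cfunK.
Qed.

Lemma differentialE (F : M -> N) (g : M) (v : tangent g) (c : chart_at g)
    (c' : chart_at (F g)) :
  {for g, continuous F} ->
  (forall (d : chart_at g) (d' : chart_at (F g)),
    differentiable (sval d' \o F \o cinv (sval d)) (sval d g)) ->
  differential F v c' = 'd (sval c' \o F \o cinv (sval c)) (sval c g) (v c).
Proof. exact: diff_change_charts. Qed.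

End Differential.

Record riemannian_metric (R : realType) (n : nat) (M : manifoldType R n) :=
  RiemannianMetric {
    inner : forall g : M, tangent g -> tangent g -> R;
    inner_sym : forall g (v w : tangent g), inner v w = inner w v;
    inner_linear : forall g (a : R) (u v w : tangent g),
      inner (a *: u + v) w = a * inner u w + inner v w;
    inner_gt0 : forall g (v : tangent g), v != 0 -> 0 < inner v v;
    inner_smooth : forall (c : chart R n M) (e e' : 'rV[R]_n), atlas c ->
      smooth_on (c @` cdom c)
        (fun u => inner (coord_field c e (cinv c u))
                        (coord_field c e' (cinv c u)) : R^o) }.

Definition riemannian_norm (R : realType) (n : nat) (M : manifoldType R n)
    (m : riemannian_metric M) (g : M) (v : tangent g) : R :=
  Num.sqrt (inner m v v).

Definition right_invariant (R : realType) (n : nat) (G : lieGroupType R n)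
    (m : riemannian_metric G) : Prop :=
  forall (h g : G) (v w : tangent g),
    inner m (differential (fun x : G => (x * h)%g) v)
            (differential (fun x : G => (x * h)%g) w) = inner m v w.

Section SphericalMilnor.
Variables (R : realType) (G : choiceType).

Definition milnor_pred : {pred (nat -> R * G)} := fun a =>
  `[< finite_set [set i | (a i).1 != 0] /\
      \sum_(i \in [set: nat]) (a i).1 ^+ 2 = 1 >].

Record milnor_family := MilnorFamily {
  milnor_val :> nat -> R * G;
  _ : milnor_val \in milnor_pred }.

HB.instance Definition _ := [isSub for milnor_val].
HB.instance Definition _ := [Choice of milnor_family by <:].

Definition milnor_coord (a : milnor_family) (i : nat) : R := (a i).1.
Definition milnor_pt (a : milnor_family) (i : nat) : G := (a i).2.

Definition milnor_equiv : rel milnor_family := fun a b =>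
  `[< forall i, milnor_coord a i = milnor_coord b i /\
        (milnor_coord a i != 0 -> milnor_pt a i = milnor_pt b i) >].

Fact milnor_equiv_is_equiv : equiv_class_of milnor_equiv.
Proof.
split=> [a|a b|b a c].
- by apply/asboolP.
- by apply/idP/idP => /asboolP h; apply/asboolP => i; have [-> k] := h i;
    split=> // /k ->.
- move=> /asboolP h1 /asboolP h2; apply/asboolP => i.
  have [e1 k1] := h1 i; have [e2 k2] := h2 i.
  by split=> [|a0]; [rewrite e1|rewrite k1// k2// -e1].
Qed.

Canonical milnor_equiv_rel := EquivRelPack milnor_equiv_is_equiv.

Definition Esph : Type := {eq_quot milnor_equiv_rel}.
HB.instance Definition _ := Choice.on Esph.
HB.instance Definition _ := EqQuotient.on Esph.

Definition milnor_support (p : Esph) : set nat :=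
  [set i | milnor_coord (repr p) i != 0].

Lemma milnor_support_pi (a : milnor_family) :
  milnor_support (\pi_Esph a) = [set i | milnor_coord a i != 0].
Proof.
have /asboolP h : milnor_equiv (repr (\pi_Esph a)) a.
  by rewrite -[_ _ _]/(milnor_equiv_rel _ _) -eqmodE reprK.
by rewrite /milnor_support; apply/funext => i; rewrite /mkset (h i).1.
Qed.

End SphericalMilnor.

Section MilnorMetric.
Variables (R : realType) (n : nat) (G : lieGroupType R n).
Implicit Types a : milnor_family R G.

(* Pairs [(v, xi)] at a representative [a], before imposing any condition. *)
Definition milnor_vector a : Type :=
  ((nat -> R) * (forall i, tangent (milnor_pt a i)))%type.

Definition milnor_vector0 a : milnor_vector a := (fun=> 0, fun=> 0).

Definition milnor_tangent a : set (milnor_vector a) :=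
  [set u | [/\ finite_set [set i | u.1 i != 0],
     \sum_(i \in [set: nat]) milnor_coord a i * u.1 i = 0 &
     finite_set [set i | u.2 i != 0]]].

(* {v finitely supported | sum_(j in J) x_j v_j = 0} (+) (+)_(j in J) T_(g_j) G,
   the second summand being extended by zero outside [J]. *)
Definition milnor_subspace a (J : set nat) : set (milnor_vector a) :=
  [set u | [/\ finite_set [set i | u.1 i != 0],
     \sum_(j \in J) milnor_coord a j * u.1 j = 0 &
     forall i, ~ J i -> u.2 i = 0]].

Definition milnor_form (m : riemannian_metric G) a (u : milnor_vector a) : R :=
  \sum_(i \in [set: nat]) u.1 i ^+ 2 +
  \sum_(i \in [set: nat])
    milnor_coord a i ^+ 2 * riemannian_norm m (u.2 i) ^+ 2.

End MilnorMetric.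

Definition positive_definite_on (R : realType) (V : Type) (zero : V)
    (A : set V) (q : V -> R) : Prop :=
  forall u, A u -> 0 <= q u /\ (q u = 0 <-> u = zero).

(* Main.v *)
Require Import Defs.
From HB Require Import structures.
From mathcomp Require Import all_boot all_order all_algebra generic_quotient.
From mathcomp Require Import all_classical all_reals all_analysis.

Set Implicit Arguments.
Unset Strict Implicit.
Unset Printing Implicit Defensive.

Import Order.TTheory GRing.Theory Num.Theory numFieldNormedType.Exports.

Local Open Scope classical_set_scope.
Local Open Scope ring_scope.
Local Open Scope quotient_scope.

(** The form is a sum of nonnegative terms, so only its zeros need thought. On
    the subspace where it is claimed definite both sums are finite: the first
    because [v] is finitely supported, the second because [x] is. A vanishing
    finite sum of nonnegative terms has all its terms equal to [0]
    ([fsumr_ge0_eq0]), whence [v_i = 0] and [x_i ^+ 2 * ||xi_i|| ^+ 2 = 0] for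
    every [i]. If [i] is in the support then [x_i != 0] and the metric of [G] is
    definite, so [xi_i = 0] ([milnor_form_eq0]); outside the support [xi_i = 0]
    by definition of the subspace.

    The degenerate directions come from the same weights: when [v = 0] and [xi]
    vanishes on the support, each remaining [||xi_i|| ^+ 2] is multiplied by
    [x_i ^+ 2 = 0] ([milnor_form_vertical]). *)

(** The finiteness assumption cannot be dropped: a [\sum_(i \in P)] whose support
    is infinite is [0] by convention. *)
Lemma fsumr_ge0_eq0 (R : realDomainType) (I : choiceType) (P : set I)
    (F : I -> R) :
  finite_set (P `&` [set i | F i != 0]) -> (forall i, P i -> 0 <= F i) ->
  \sum_(i \in P) F i = 0 -> forall i, P i -> F i = 0.
Proof.
move=> finF F_ge0; rewrite fsbig_supp => sum0 i Pi.
have suppE : P `&` F @^-1` [set~ 0] = P `&` [set i | F i != 0].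
  by apply/seteqP; split=> j /= -[Pj /eqP].
apply/eqP; apply: contraT => Fi_neq0.
move: sum0; rewrite suppE => sum0.
case/eqP: (Fi_neq0); apply: (pfsumr_eq0 finF _ sum0); last by split.
by move=> j [/F_ge0].
Qed.

Section Norm.
Variables (R : realType) (n : nat) (M : manifoldType R n).
Variable m : riemannian_metric M.

Lemma riemannian_norm0 (g : M) : riemannian_norm m (0 : tangent g) = 0.
Proof.
have inner0 : inner m (0 : tangent g) 0 = 0.
  have /eqP := inner_linear m 1 (0 : tangent g) 0 0.
  by rewrite scaler0 addr0 mul1r addrC -subr_eq subrr => /eqP.
by rewrite /riemannian_norm inner0 sqrtr0.
Qed.

Lemma riemannian_norm_eq0 (g : M) (v : tangent g) :
  (riemannian_norm m v == 0) = (v == 0).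
Proof.
apply/idP/eqP => [|->]; last by rewrite riemannian_norm0.
apply: contraTeq => v_neq0.
by rewrite /riemannian_norm gt_eqF// sqrtr_gt0 inner_gt0.
Qed.

End Norm.

Section Form.
Variables (R : realType) (n : nat) (G : lieGroupType R n).
Variables (m : riemannian_metric G) (a : milnor_family R G).

Lemma milnor_coord_finite : finite_set [set i | milnor_coord a i != 0].
Proof. by have := valP a; rewrite unfold_in => /asboolP[]. Qed.

Lemma milnor_form_ge0 (u : milnor_vector a) : 0 <= milnor_form m u.
Proof.
apply: addr_ge0; apply: fsumr_ge0 => i _; first exact: sqr_ge0.
by rewrite mulr_ge0// sqr_ge0.
Qed.

(** At each index one of the two factors of the second sum is [0]. *)
Lemma milnor_form_vertical (xi : forall i, tangent (milnor_pt a i)) :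
  (forall j, milnor_coord a j != 0 -> xi j = 0) ->
  milnor_form m ((fun=> 0, xi) : milnor_vector a) = 0.
Proof.
move=> xi0; rewrite /milnor_form !fsbig1 ?addr0// => i _ /=.
  have [->|/xi0 ->] := eqVneq (milnor_coord a i) 0.
    by rewrite expr0n mul0r.
  by rewrite riemannian_norm0 expr0n mulr0.
by rewrite expr0n.
Qed.

(** The weight [x_i ^+ 2] confines the conclusion on [u.2] to the support, and
    also makes the second sum finite, so that its terms can be separated. *)
Lemma milnor_form_eq0 (u : milnor_vector a) :
  finite_set [set i | u.1 i != 0] -> milnor_form m u = 0 ->
  (forall i, u.1 i = 0) /\ (forall i, milnor_coord a i != 0 -> u.2 i = 0).
Proof.
move=> finv /eqP; rewrite /milnor_form paddr_eq0; last first.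
- by apply: fsumr_ge0 => i _; rewrite mulr_ge0// sqr_ge0.
- by apply: fsumr_ge0 => i _; rewrite sqr_ge0.
move=> /andP[/eqP sumv0 /eqP sumxi0]; split=> [i|i ai_neq0].
  apply/eqP; rewrite -sqrf_eq0; apply/eqP; move: i (I : [set: nat] i).
  apply: fsumr_ge0_eq0 sumv0 => [|j _]; last exact: sqr_ge0.
  by apply: sub_finite_set finv => j /= -[_]; rewrite sqrf_eq0.
have /eqP : milnor_coord a i ^+ 2 * riemannian_norm m (u.2 i) ^+ 2 = 0.
  move: {ai_neq0} i (I : [set: nat] i).
  apply: fsumr_ge0_eq0 sumxi0 => [|j _]; last by rewrite mulr_ge0// sqr_ge0.
  apply: sub_finite_set milnor_coord_finite => j /= -[_].
  by rewrite mulf_eq0 sqrf_eq0 => /norP[].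
by rewrite mulf_eq0 !sqrf_eq0 (negbTE ai_neq0) riemannian_norm_eq0 => /eqP.
Qed.

End Form.

Theorem proposition6p14 (R : realType) (n : nat) (G : lieGroupType R n)
    (m : riemannian_metric G) (hm : right_invariant m)
    (p : Esph R G) (a : milnor_family R G) (hp : p = \pi_(Esph R G) a) :
  let J := milnor_support p in
  positive_definite_on (milnor_vector0 a) (@milnor_subspace R n G a J)
    (@milnor_form R n G m a) /\
  (forall xi : forall i, tangent (milnor_pt a i),
     @milnor_tangent R n G a (fun=> 0, xi) ->
     (forall j, J j -> xi j = 0) ->
     @milnor_form R n G m a (fun=> 0, xi) = 0).
Proof.
move=> J.
have JE : J = [set i | milnor_coord a i != 0] by rewrite /J hp milnor_support_pi.
split=> [[v xi] [/= finv _ xi_out]|xi _ xi0]; last first.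
  by apply: milnor_form_vertical => j aj; apply: xi0; rewrite JE.
split; first exact: milnor_form_ge0.
split=> [form0|->]; last exact: milnor_form_vertical.
have [v0 xi0] := @milnor_form_eq0 _ _ _ m a (v, xi) finv form0.
congr (_, _); first exact/funext.
apply: functional_extensionality_dep => i.
have [Ji|/xi_out//] := pselect (J i).
by apply: xi0; move: Ji; rewrite JE.
Qed.
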